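(* Let $N\ge2$, $M\ge2$ and $Q$ be integers with $1\le Q\le M-1$, write $\mathcal{M}=\{1,\dots,M\}$, let $0<\epsilon<1$, and let $\mathbf{H}_1,\dots,\mathbf{H}_M$ be $N\times N$ complex Hermitian positive semidefinite matrices. Let $v^{\max}_{\rm QP}$ be the optimal value of (P2): maximize $\|\mathbf{w}\|^2$ over $\mathbf{w}\in\mathbb{C}^N$, $\boldsymbol\beta\in\{0,1\}^M$ subject to $\mathbf{w}^H\mathbf{H}_i\mathbf{w}\le\beta_i\epsilon+(1-\beta_i)$ ($i\in\mathcal{M}$) and $\sum_i\beta_i=Q$; and let $v^{\max}_{\rm SDP}$ be the optimal value of (SDP3): maximize $\mathrm{Tr}[\mathbf{X}]$ over Hermitian $N\times N$ matrices $\mathbf{X}\succeq0$ and $\boldsymbol\beta\in\mathbb{R}^M$ subject to $\mathrm{Tr}[\mathbf{H}_i\mathbf{X}]\le\beta_i\epsilon+(1-\beta_i)$ ($i\in\mathcal{M}$), $\sum_i\beta_i=Q$, $0\le\beta_i\le1$. Then $$v^{\max}_{\rm QP}\ge\frac{\epsilon}{\tilde c(\epsilon)}\cdot\frac{1}{4\ln(100K)}\,v^{\max}_{\rm SDP},$$ where $K=\sum_{i=1}^M\min\{\mathrm{rank}(\mathbf{H}_i),\sqrt{M}\}$ and $\tilde c(\epsilon)=1-\frac{1-\epsilon}{M-Q+1}$.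
   Context: ${}^H$ denotes conjugate transpose. *)

(* Defs.v *)
From HB Require Import structures.
From mathcomp Require Import all_boot all_order all_algebra.
From mathcomp Require Import complex.
From mathcomp Require Import all_classical all_reals.
From mathcomp Require Import ereal exp.
Set Implicit Arguments. Unset Strict Implicit. Unset Printing Implicit Defensive.
Import Order.TTheory GRing.Theory Num.Theory.
Local Open Scope ring_scope.
Local Open Scope complex_scope.

Definition ctmx {R : rcfType} m n (A : 'M[R[i]]_(m, n)) : 'M[R[i]]_(n, m) :=
  (map_mx conjc A)^T.

Definition hermitian {R : rcfType} n (A : 'M[R[i]]_n) : Prop := ctmx A = A.

(* positive semidefinite: Hermitian and v^H A v >= 0 (as a complex number,
   i.e. real and nonnegative) for all v *)
Definition psd {R : rcfType} n (A : 'M[R[i]]_n) : Prop :=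
  hermitian A /\ forall v : 'cV[R[i]]_n, 0 <= (ctmx v *m A *m v) 0 0.

Definition qform {R : rcfType} n (H : 'M[R[i]]_n) (w : 'cV[R[i]]_n) : R[i] :=
  (ctmx w *m H *m w) 0 0.

Definition normsq {R : rcfType} n (w : 'cV[R[i]]_n) : R :=
  \sum_(k < n) (complex.Re (w k 0) ^+ 2 + complex.Im (w k 0) ^+ 2).

Definition P2_values {R : rcfType} (N M Q : nat) (eps : R)
  (H : 'I_M -> 'M[R[i]]_N) : set R :=
  [set t | exists (w : 'cV[R[i]]_N) (beta : 'I_M -> bool),
     [/\ forall i, qform (H i) w <= ((beta i)%:R * eps + (1 - (beta i)%:R))%:C,
         (\sum_(i < M) (beta i : nat))%N = Q &
         t = normsq w]].

Definition SDP3_values {R : rcfType} (N M Q : nat) (eps : R)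
  (H : 'I_M -> 'M[R[i]]_N) : set R :=
  [set t | exists (X : 'M[R[i]]_N) (beta : 'I_M -> R),
     [/\ psd X,
         forall i, \tr (H i *m X) <= (beta i * eps + (1 - beta i))%:C,
         \sum_(i < M) beta i = Q%:R,
         forall i, 0 <= beta i <= 1 &
         t = complex.Re (\tr X)]].

Definition v_QP {R : realType} N M Q (eps : R) H : \bar R :=
  ereal_sup [set x%:E | x in @P2_values R N M Q eps H].
Definition v_SDP {R : realType} N M Q (eps : R) H : \bar R :=
  ereal_sup [set x%:E | x in @SDP3_values R N M Q eps H].

Definition K_const {R : rcfType} N M (H : 'I_M -> 'M[R[i]]_N) : R :=
  \sum_(i < M) Num.min ((\rank (H i))%:R) (Num.sqrt (M%:R)).

Definition ctilde {R : rcfType} (M Q : nat) (eps : R) : R :=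
  1 - (1 - eps) / ((M - Q)%:R + 1).

(* Main.v *)
Require Import Defs.
From HB Require Import structures.
From mathcomp Require Import all_boot all_order all_algebra.
From mathcomp Require Import spectral zify ring lra.
From mathcomp Require Import complex.
From mathcomp Require Import all_classical all_reals.
From mathcomp Require Import ereal sequences exp.
Import Order.TTheory GRing.Theory Num.Theory.
Local Open Scope ring_scope.
Set Implicit Arguments. Unset Strict Implicit. Unset Printing Implicit Defensive.

(* Rounding: at least Q of the beta_i are >= 1 / (M - Q + 1); fixing Q of them to
   1 and multiplying X by eps / ctilde gives a feasible point of the relaxation
   with binary beta and bounds b_i in {eps, 1}.  Write X = sum_k z_k z_k^H with
   z_k orthogonal (spectral theorem) and w = sum_k +-z_k: then |w|^2 = Tr X for
   all signs.  For random signs, iterating cosh x <= exp (7/8 x^2) and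
   Cauchy-Schwarz for the form of H_i bounds E exp (w^H H_i w / (4 b_i)) by e^2,
   whatever the rank of H_i.  Since the number of nonzero H_i is at most K and
   e^2 <= 100, some choice of signs gives w^H H_i w <= 4 ln (100 K) b_i for all i
   simultaneously, and w is rescaled. *)

(** * Exponential bounds and the choice of signs *)

(** From [1 - x/2 <= exp (-x/2)] follows [exp x <= (1 - x/2)^-2]. The bounds for [x] and [-x] add up
    to [2 (1 + 3/4 x^2)] to second order; the slack between [3/4] and [7/8] absorbs the higher terms
    for [|x| <= 1/2]. *)
Lemma cosh_le_expR_small (R : realType) (x : R) : `|x| <= 1/2 ->
  expR x + expR (- x) <= 2 * expR (7/8 * x ^+ 2).
Proof.
move=> xs.
have inv_bound (y : R) : `|y| <= 1/2 -> expR y * (1 - y/2) ^+ 2 <= 1.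
  move=> ys; have := expR_ge1Dx (- (y/2)); move: ys; rewrite ler_norml => /andP[y1 y2] h.
  have -> : expR y = expR (y/2) ^+ 2 by rewrite expr2 -expRD; congr expR; field.
  rewrite -exprMn -[leRHS](expr1n _ 2) lerXn2r ?nnegrE ?mulr_ge0 ?expR_ge0 //; first by lra.
  by rewrite -[leRHS](expRxMexpNx_1 (y/2)) ler_pM2l ?expR_gt0.
have h1 := inv_bound x xs; have h2 := inv_bound (- x) _.
move: h2; rewrite normrN => /(_ xs) h2.
have h3 := expR_ge1Dx (7/8 * x ^+ 2).
move: xs; rewrite ler_norml => /andP[x1 x2].
apply: le_trans (_ : 2 * (1 + 7/8 * x ^+ 2) <= _); last by lra.
set D := (1 - x/2) ^+ 2 * (1 + x / 2) ^+ 2.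
have D0 : 0 < D by rewrite mulr_gt0 // exprn_gt0 //; lra.
rewrite -(ler_pM2r D0).
apply: le_trans (_ : (1 + x/2)^+2 + (1 - x/2)^+2 <= _).
  rewrite mulrDl /D lerD //.
    by rewrite mulrA ler_piMl // sqr_ge0.
  rewrite mulrCA ler_piMr ?sqr_ge0 //.
  by move: h2; rewrite mulNr opprK.
have x21 : x^+2 <= 1/4 by nra.
have x20 := sqr_ge0 x.
rewrite /D; set y := x^+2 in x20 x21 *.
have -> : (1 + x/2)^+2 + (1 - x/2)^+2 = 2 + y/2 by rewrite /y; field.
have -> : (1 - x/2)^+2 * (1 + x/2)^+2 = (1 - y/4)^+2 by rewrite /y; field.
have y2 : 0 <= y * (1/4 - y) by apply: mulr_ge0 => //; lra.
have y3 : 0 <= y ^+ 3 by apply: exprn_ge0.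
rewrite -subr_ge0.
rewrite (_ : _ - _ = 3/4 * (y * (1/4 - y)) + y/16 + 7/64 * y ^+ 3);
  last by field.
by lra.
Qed.

(* The duplication formula cosh 2y = 2 cosh^2 y - 1 propagates the bound from
   small arguments. *)
Lemma cosh_le_expR (R : realType) (x : R) :
  expR x + expR (- x) <= 2 * expR (7/8 * x ^+ 2).
Proof.
suff H n (y : R) : `|y| <= 2 ^+ n / 2 -> expR y + expR (- y) <= 2 * expR (7/8 * y ^+ 2).
  apply: (H (Num.truncn `|x|).+2); apply/ltW.
  apply: lt_le_trans (truncnS_gt _) _.
  rewrite exprS mulrAC mulfV // mul1r -natrX ler_nat; apply: ltnW. exact: ltn_expl.
elim: n y => [|n IH] y yn; first by apply: cosh_le_expR_small; rewrite expr0 in yn.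
have /IH h : `|y/2| <= 2^+n / 2.
  by rewrite normrM [`|2^-1|]ger0_norm // ler_pM2r //; move: yn; rewrite exprS; lra.
have -> : expR y = expR (y/2) ^+ 2 by rewrite expr2 -expRD; congr expR; field.
have -> : expR (- y) = expR (-(y/2)) ^+ 2 by rewrite expr2 -expRD; congr expR; field.
have -> : expR (7/8 * y^+2) = expR (7/8 * (y/2)^+2) ^+ 4.
  by rewrite -expRM_natl; congr expR; field.
have e1 := expRxMexpNx_1 (y/2).
have := expR_gt0 (y/2); have := expR_gt0 (-(y/2)).
move: h e1; set a := expR (y/2); set b := expR (- _); set c := expR _ => h e1 a0 b0.
have h2 : (a + b)^+2 <= (2 * c)^+2 by rewrite lerXn2r // nnegrE; lra.
have -> : a^+2 + b^+2 = (a+b)^+2 - 2 by ring: e1.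
(* The remaining inequality [4 c^2 - 2 <= 2 c^4] is [2 (c^2 - 1)^2 >= 0]. *)
have := sqr_ge0 (c^+2 - 1); nra.
Qed.

(* The induction is the method of conditional expectations: averaging the
   potential over the sign of the first vector does not increase it. *)
Lemma exists_signs (R : realType) (V : zmodType) (I : finType) (P : pred I)
  (q : I -> V -> R) (b : I -> V -> V -> R)
  (q_ge0 : forall i x, 0 <= q i x)
  (qD : forall i x y, q i (x + y) = q i x + q i y + 2 * b i x y)
  (qB : forall i x y, q i (x - y) = q i x + q i y - 2 * b i x y)
  (CS : forall i x y, b i x y ^+ 2 <= q i x * q i y)
  (c : R) (n : nat) (z : 'I_n -> V) (v : V) :
  (forall i, P i -> 7/2 * (\sum_k q i (z k)) < c) ->
  exists e : 'I_n -> bool,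
    \sum_(i | P i) expR (q i (v + \sum_k (if e k then - z k else z k)) / c) <=
    \sum_(i | P i)
      expR ((q i v + \sum_k q i (z k)) / (c - 7/2 * \sum_k q i (z k))).
Proof.
elim: n z v => [|n IH] z v zc.
  exists (fun=> false); rewrite !big_ord0 addr0.
  by apply: ler_sum => i Pi; rewrite !big_ord0 mulr0 subr0 addr0.
pose s i : R := \sum_(k < n) q i (z (lift ord0 k)).
(* [F u] is the potential once the first sign is fixed, [u] being the partial signed sum and [s i]
   the mass still to come; [G] below is the potential before that choice. *)
pose F u := \sum_(i | P i) expR ((q i u + s i) / (c - 7/2 * s i)).
have s_ge0 i : 0 <= s i by apply: sumr_ge0.
have sE i : \sum_k q i (z k) = q i (z ord0) + s i by rewrite big_ord_recl.
pose a := z ord0.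
pose G := \sum_(i | P i)
  expR ((q i v + \sum_k q i (z k)) / (c - 7/2 * \sum_k q i (z k))).
have avg : F (v + a) + F (v - a) <= 2 * G.
  rewrite /F /G -big_split /= mulr_sumr; apply: ler_sum => i Pi.
  have := zc i Pi; rewrite sE -/a qD qB => ci.
  have := CS i v a; have := q_ge0 i v; have := q_ge0 i a; have := s_ge0 i.
  move: ci; set A := q i a; set S := s i; set W := q i v; set B := b i v a.
  move=> ci S0 A0 W0 cs.
  set d := c - 7/2 * S; have d0 : 0 < d by rewrite /d; lra.
  have -> : (W + A + 2 * B + S) / d = (W + A + S) / d + 2 * B / d by field; lra.
  have -> : (W + A - 2 * B + S) / d = (W + A + S) / d - 2 * B / d by field; lra.
  (* By the cosh bound at [2 B / d] and [B^2 <= W A], averaging over the sign adds at most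
     [7/2 W A / d^2] to the exponent [(W + A + S) / d], where [7/2 = 4 * 7/8]. The total stays below
     [(W + A + S) / (d - 7/2 A)]. *)
  rewrite !expRD -mulrDr.
  apply: le_trans (ler_wpM2l (expR_ge0 _) (cosh_le_expR _)) _.
  rewrite mulrCA ler_pM2l // -expRD ler_expR.
  have -> : c - 7/2 * (A + S) = d - 7/2 * A by rewrite /d; ring.
  have dA : 0 < d - 7/2 * A by rewrite /d; lra.
  rewrite ler_pdivlMr // -(@ler_pM2r _ (d^+2)) ?exprn_gt0 //.
  rewrite (_ : (_ + _) * _ * _ =
    ((W + A + S) * d + 7/2 * B ^+ 2) * (d - 7/2 * A)); last by field; lra.
  apply: le_trans (_ : ((W + A + S) * d + 7/2 * (W * A)) * (d - 7/2 * A) <= _).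
    by rewrite ler_pM2r // lerD2l ler_pM2l //; lra.
  rewrite -subr_ge0.
  rewrite (_ : _ - _ = (A + S) * (7/2 * A * d) + W * (7/2 * A) ^+ 2); last by field.
  by apply: addr_ge0; apply: mulr_ge0; rewrite ?sqr_ge0 ?mulr_ge0 //; lra.
have [u Fu] : exists u : bool, F (v + (if u then - a else a)) <= G.
  have [h|h] := leP (F (v + a)) G; first by exists false.
  by exists true; move: avg h; lra.
have [i Pi|e he] := IH (fun k => z (lift ord0 k)) (v + (if u then - a else a)).
  by apply: le_lt_trans (zc i Pi); rewrite sE ler_pM2l ?lerDr ?q_ge0.
exists (fun k => if unlift ord0 k is Some j then e j else u).
apply: le_trans (le_trans he Fu).
apply: ler_sum => i Pi; rewrite big_ord_recl unlift_none addrA.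
by under eq_bigr do rewrite liftK.
Qed.

(** * Hermitian forms and orthogonal decomposition *)

Local Open Scope complex_scope.

Lemma ctmxD (R : rcfType) m n (A B : 'M[R[i]]_(m, n)) :
  ctmx (A + B) = ctmx A + ctmx B.
Proof. by rewrite /ctmx map_mxD linearD. Qed.

Lemma ctmxZ (R : rcfType) m n (a : R[i]) (A : 'M[R[i]]_(m, n)) :
  ctmx (a *: A) = conjc a *: ctmx A.
Proof. by rewrite /ctmx map_mxZ linearZ. Qed.

Lemma ctmxM (R : rcfType) m n p (A : 'M[R[i]]_(m, n)) (B : 'M[R[i]]_(n, p)) :
  ctmx (A *m B) = ctmx B *m ctmx A.
Proof. by rewrite /ctmx map_mxM trmx_mul. Qed.

Lemma ctmxK (R : rcfType) m n (A : 'M[R[i]]_(m, n)) : ctmx (ctmx A) = A.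
Proof. by apply/matrixP => i j; rewrite !mxE conjcK. Qed.

Lemma normsqE (R : rcfType) n (w : 'cV[R[i]]_n) :
  (ctmx w *m w) 0 0 = (normsq w)%:C.
Proof.
rewrite mxE /normsq rmorph_sum; apply: eq_bigr => k _.
rewrite !mxE; case: (w k 0) => a b /=.
by apply/eqP; rewrite eq_complex /=; apply/andP; split; apply/eqP; ring.
Qed.

Section PsdForm.
Variables (R : rcfType) (n : nat) (H : 'M[R[i]]_n).
Hypothesis psdH : psd H.

(** Taking real parts turns the Hermitian form into a real quadratic form with symmetric real
    bilinear companion [bre], as [exists_signs] requires. *)
Definition qre (x : 'cV[R[i]]_n) : R := complex.Re (qform H x).
Definition bre (x y : 'cV[R[i]]_n) : R :=
  complex.Re ((ctmx x *m H *m y) 0 0).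

Lemma qformE x : qform H x = (qre x)%:C.
Proof.
have := psdH.2 x; rewrite -/(qform H x) lecE /= /qre => /andP[/eqP e _].
by case: (qform H x) e => a b /= ->.
Qed.

Lemma qre_ge0 x : 0 <= qre x.
Proof. by have := psdH.2 x; rewrite lecE /= => /andP[]. Qed.

Lemma breC x y : bre x y = bre y x.
Proof.
rewrite /bre; have -> : ctmx y *m H *m x = ctmx (ctmx x *m H *m y).
  by rewrite !ctmxM ctmxK (psdH.1) mulmxA.
by rewrite !mxE; case: (\sum_j _).
Qed.

Lemma qreD x y : qre (x + y) = qre x + qre y + 2 * bre x y.
Proof.
rewrite /qre /qform ctmxD !(mulmxDl, mulmxDr) !mxE.
rewrite !raddfD /=.
have := breC y x; rewrite /bre !mxE => ->.
by ring.
Qed.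

Lemma qreZ (t : R) x : qre (t%:C *: x) = t ^+ 2 * qre x.
Proof.
rewrite /qre /qform ctmxZ -scalemxAl -scalemxAl -scalemxAr !mxE.
by case: (\sum_j _) => a b /=; ring.
Qed.

Lemma breZ (t : R) x y : bre x (t%:C *: y) = t * bre x y.
Proof.
by rewrite /bre -scalemxAr mxE; case: (fun_of_matrix _ _ _) => a b /=; ring.
Qed.

Lemma qreB x y : qre (x - y) = qre x + qre y - 2 * bre x y.
Proof.
have -> : x - y = x + (-1)%:C *: y by rewrite rmorphN rmorph1 scaleN1r.
by rewrite qreD qreZ breZ; ring.
Qed.

Lemma bre_CauchySchwarz x y : bre x y ^+ 2 <= qre x * qre y.
Proof.
have h t : 0 <= qre x + t ^+ 2 * qre y + 2 * (t * bre x y).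
  by rewrite -qreZ -breZ -qreD qre_ge0.
have [y0|] := eqVneq (qre y) 0; last first.
  move=> yn0; have y0 : 0 < qre y by rewrite lt_def yn0 qre_ge0.
  have := h (- bre x y / qre y); rewrite -(ler_pM2r y0) mul0r.
  rewrite (_ : (_ + _) * _ = qre x * qre y - bre x y ^+ 2); first by rewrite subr_ge0.
  by field.
rewrite y0 mulr0; have [->|bn0] := eqVneq (bre x y) 0; first by rewrite expr0n.
(* When [qre y = 0] the polynomial in [t] is affine; this [t] would give it the value [-1]. *)
have := h (- (qre x + 1) / (2 * bre x y)); rewrite y0 mulr0 addr0.
rewrite (_ : _ + _ = - 1); first by lra.
by field.
Qed.

End PsdForm.

Lemma qformZ (R : rcfType) n (H : 'M[R[i]]_n) (t : R) x :
  qform H (t%:C *: x) = (t ^+ 2)%:C * qform H x.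
Proof.
rewrite /qform ctmxZ -scalemxAl -scalemxAl -scalemxAr !mxE mulrA; congr (_ * _).
by rewrite rmorphXn expr2 /=; congr (_ * _); rewrite oppr0.
Qed.

Lemma normsqZ (R : rcfType) n (t : R) (w : 'cV[R[i]]_n) :
  normsq (t%:C *: w) = t ^+ 2 * normsq w.
Proof.
rewrite /normsq mulr_sumr; apply: eq_bigr => k _; rewrite mxE.
by case: (w k 0) => a b /=; ring.
Qed.

(* The columns of Z = U D^(1/2), from the spectral decomposition X = U D U^*,
   are orthogonal, so the norm of a signed sum does not depend on the signs. *)
Lemma psd_orthogonal_decomposition (R : rcfType) n (X : 'M[R[i]]_n) : psd X ->
  exists z : 'I_n -> 'cV[R[i]]_n,
    (forall H, \sum_k qform H (z k) = \tr (H *m X)) /\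
    forall e : 'I_n -> bool,
      normsq (\sum_k (if e k then - z k else z k)) = complex.Re (\tr X).
Proof.
move=> psdX; pose P := spectralmx X; pose d := spectral_diag X.
have ctE m p (A : 'M[R[i]]_(m, p)) : ctmx A = map_mx Num.conj A^T.
  by apply/matrixP => i j; rewrite !mxE.
have PP : P *m ctmx P = 1%:M.
  by rewrite ctE; apply/unitarymxP; exact: spectral_unitarymx.
have XE : X = ctmx P *m diag_mx d *m P.
  have /orthomx_spectralP : X \is normalmx.
    by apply/normalmxP; rewrite -ctE psdX.1.
  by rewrite invmx_unitary ?spectral_unitarymx // -ctE.
have DE : diag_mx d = P *m X *m ctmx P.
  by rewrite XE !mulmxA PP mul1mx -mulmxA PP mulmx1.
(* Column [k] of [ctmx P] is an eigenvector, on which the form of [X] takes the value [d 0 k]. *)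
have d_ge0 k : 0 <= d 0 k.
  have := psdX.2 (col k (ctmx P)).
  rewrite colE ctmxM ctmxK -mulmxA -[_ *m (X *m _)]mulmxA (mulmxA X) (mulmxA P) (mulmxA P) -DE.
  rewrite -colE.
  rewrite (_ : ctmx (delta_mx k 0) = delta_mx 0 k); last first.
    by apply/matrixP => i j; rewrite !mxE andbC; case: (_ && _); rewrite /= oppr0.
  by rewrite -rowE !mxE eqxx.
pose r k := Num.sqrt (complex.Re (d 0 k)).
have rE k : d 0 k = (r k)%:C * (r k)%:C.
  have := d_ge0 k; rewrite lecE /= => /andP[/eqP e h].
  rewrite -rmorphM -expr2 sqr_sqrtr //.
  by case: (d 0 k) e => a b /= ->.
pose S := diag_mx (\row_k (r k)%:C).
have SS : S *m S = diag_mx d.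
  by rewrite mulmx_diag; congr diag_mx; apply/rowP => k; rewrite !mxE rE.
have Sc : ctmx S = S.
  apply/matrixP => i j; rewrite !mxE eq_sym.
  by case: eqP => [->|_]; rewrite ?mulr1n ?mulr0n /= oppr0.
pose Z := ctmx P *m S.
have ZZ : Z *m ctmx Z = X.
  by rewrite /Z ctmxM Sc ctmxK mulmxA -[ctmx P *m S *m S]mulmxA SS -XE.
have ZZ' : ctmx Z *m Z = diag_mx d.
  by rewrite /Z ctmxM Sc ctmxK mulmxA -[S *m P *m _]mulmxA PP mulmx1 SS.
exists (fun k => col k Z); split.
  move=> H; rewrite -ZZ mulmxA mxtrace_mulC mulmxA.
  apply: eq_bigr => k _; rewrite /qform !mxE; apply: eq_bigr => j _; rewrite !mxE.
  by congr (_ * _); apply: eq_bigr => l _; rewrite !mxE.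
move=> e; pose xi : 'cV[R[i]]_n := \col_k (if e k then -1 else 1).
have -> : \sum_k (if e k then - col k Z else col k Z) = Z *m xi.
  apply/colP => i; rewrite summxE !mxE; apply: eq_bigr => k _.
  by rewrite !mxE; case: (e k); rewrite !mxE ?mulrN mulr1.
(* [|Z xi|^2 = xi^H D xi], which is [Tr D = Tr X] because the entries of [xi] are signs. *)
rewrite -[LHS]/(complex.Re (normsq (Z *m xi))%:C) -normsqE; congr complex.Re.
rewrite ctmxM mulmxA -[_ *m Z]mulmxA ZZ' -ZZ mxtrace_mulC ZZ' mxtrace_diag.
rewrite mxE; apply: eq_bigr => k _.
rewrite mul_mx_diag !mxE.
case: (e k); case: (d 0 k) => a b; apply/eqP; rewrite eq_complex /=;
  by apply/andP; split; apply/eqP; ring.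
Qed.

(** * Rounding of [beta] and of [X] *)

(** If at most [Q - 1] coordinates reached the threshold [th], the sum would be less than
    [(Q - 1) + (M - Q + 1) th = Q]. *)
Lemma exists_large_coordinates (R : realFieldType) (M Q : nat)
  (beta : 'I_M -> R) : (Q <= M)%N -> \sum_(i < M) beta i = Q%:R ->
  (forall i, beta i <= 1) ->
  exists A : {set 'I_M}, #|A| = Q /\
    forall i, i \in A -> ((M - Q)%:R + 1)^-1 <= beta i.
Proof.
move=> QM bQ b1; set th := _^-1.
pose S := [set i | th <= beta i].
suff /card_geqP[s [us sQ sS]] : (Q <= #|S|)%N.
  exists [set i in s]; split; first by rewrite cardsE (card_uniqP us).
  by move=> i; rewrite inE => /sS; rewrite inE.
rewrite leqNgt; apply/negP => SQ.
have SC : (#|S| + #|~: S| = M)%N by rewrite cardsC card_ord.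
have lt1 : \sum_(i in S) beta i <= #|S|%:R.
  by rewrite -sumr_const; apply: ler_sum.
have lt2 : \sum_(i in ~: S) beta i < #|~: S|%:R * th.
  rewrite mulr_natl -sumr_const; apply: ltr_sum.
    have /card_gt0P[i iS] : (0 < #|~: S|)%N by lia.
    by apply/hasP; exists i => //; rewrite mem_index_enum.
  by move=> i; rewrite !inE -ltNge.
have : Q%:R < #|S|%:R + #|~: S|%:R * th.
  rewrite -bQ (bigID (mem S)) /= ler_ltD //.
  by apply: le_lt_trans lt2; under [leRHS]eq_bigl do rewrite inE.
(* [m] is the deficit of [S] below [Q - 1]; these extra small coordinates contribute [m th <= m]. *)
have [m mE] : exists m, Q = (#|S| + m.+1)%N by exists (Q - #|S|).-1; lia.
have -> : #|~: S| = ((M - Q) + 1 + m)%N by lia.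
rewrite {1}mE !natrD -/th.
have D0 : 0 < (M - Q)%:R + 1 :> R by rewrite ltr_wpDl ?ler0n.
have th1 : th <= 1 by rewrite invf_le1 // lerDr ler0n.
rewrite mulrDl mulfV ?gt_eqF // -natr1.
have : m%:R * th <= m%:R by rewrite ler_piMr ?ler0n.
by lra.
Qed.

Lemma expR2_le100 (R : realType) : expR 2 <= 100 :> R.
Proof.
have -> : expR 2 = expR (1/2) ^+ 4 :> R by rewrite -expRM_natl; congr expR; field.
have h := expR_ge1Dx (- (1/2) : R); have e := expRxMexpNx_1 (1/2 : R).
have p := expR_gt0 (1/2 : R).
have h2 : expR (1/2) <= 2 :> R by nra.
apply: le_trans (_ : 2 ^+ 4 <= _); first by rewrite lerXn2r ?nnegrE // ltW.
by rewrite -natrX ler_nat.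
Qed.

(** A nonzero matrix has rank at least 1 and [sqrt M >= 1], so it contributes at least 1 to
    [K_const H]. *)
Lemma card_nonzero_le_K (R : rcfType) N M (H : 'I_M -> 'M[R[i]]_N) :
  (0 < M)%N -> #|[pred i | H i != 0]|%:R <= K_const H.
Proof.
move=> M0; rewrite -sumr_const /K_const big_mkcond /=; apply: ler_sum => i _.
rewrite inE; case: eqP => [_|/eqP Hi] /=.
  by rewrite le_min ler0n sqrtr_ge0.
by rewrite le_min ler1n lt0n mxrank_eq0 Hi -{1}sqrtr1 ler_wsqrtr // ler1n.
Qed.

(** The weights [g i] normalise constraints with different right-hand sides to the common bound
    1. *)
Lemma exists_sign_rounding (R : realType) N M (H : 'I_M -> 'M[R[i]]_N)
  (g : 'I_M -> R) (X : 'M[R[i]]_N) :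
  (forall i, psd (H i)) -> psd X -> (exists i, H i != 0) ->
  (forall i, 0 <= g i) ->
  (forall i, g i * complex.Re (\tr (H i *m X)) <= 1) ->
  exists w : 'cV[R[i]]_N, normsq w = complex.Re (\tr X) /\
    forall i, g i * qre (H i) w <= 4 * ln (100 * K_const H).
Proof.
move=> psdH psdX [i0 Hi0] g0 gX.
have M0 : (0 < M)%N by apply: leq_ltn_trans (ltn_ord i0).
have [z [zH zX]] := psd_orthogonal_decomposition psdX.
have zg i : \sum_k g i * qre (H i) (z k) = g i * complex.Re (\tr (H i *m X)).
  by rewrite -zH raddf_sum -mulr_sumr.
have zg0 i : 0 <= \sum_k g i * qre (H i) (z k).
  by apply: sumr_ge0 => k _; rewrite mulr_ge0 ?g0 ?qre_ge0.
have zg1 i : \sum_k g i * qre (H i) (z k) <= 1 by rewrite zg.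
(* With total mass at most 1 and [c = 4], the denominator [4 - 7/2 s] is at least [1/2], so each
   initial term is at most [exp 2]. *)
have [||||i _|e he] := @exists_signs R _ _ [pred i | H i != 0]
  (fun i x => g i * qre (H i) x) (fun i x y => g i * bre (H i) x y) _ _ _ _ 4 _ z 0.
- by move=> i x; rewrite mulr_ge0 ?g0 ?qre_ge0.
- by move=> i x y; rewrite qreD //; ring.
- by move=> i x y; rewrite qreB //; ring.
- move=> i x y; rewrite exprMn [leRHS]mulrACA -expr2 ler_wpM2l ?sqr_ge0 //.
  exact: bre_CauchySchwarz.
- by have := zg1 i; lra.
set w := 0 + _ in he; exists w; split; first by rewrite /w add0r zX.
have K1 := card_nonzero_le_K H M0.
have P1 : 1 <= #|[pred i | H i != 0]|%:R :> R.
  by rewrite ler1n; apply/card_gt0P; exists i0.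
have T1 : 1 <= 100 * K_const H by lra.
move=> i; have [->|Hi] := eqVneq (H i) 0.
  rewrite /qre /qform mulmx0 mul0mx mxE mulr0; apply: mulr_ge0 => //; exact: ln_ge0.
suff h : expR (g i * qre (H i) w / 4) <= 100 * K_const H.
  have : g i * qre (H i) w / 4 <= ln (100 * K_const H).
    by rewrite -ler_expR lnK // posrE; lra.
  by lra.
(* One term is at most the whole sum of positive terms. *)
apply: le_trans (_ : _ <= \sum_(i | [pred i | H i != 0] i) expR (g i * qre (H i) w / 4)) _.
  rewrite (bigD1 i) //= lerDl; apply: sumr_ge0 => *; exact: expR_ge0.
apply: le_trans he _.
apply: le_trans (_ : _ <= \sum_(i | [pred i | H i != 0] i) 100) _; last first.
  by rewrite sumr_const -[leLHS]mulr_natr ler_pM2l.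
apply: ler_sum => j _; apply: le_trans (expR2_le100 R); rewrite ler_expR.
have -> : qre (H j) 0 = 0 by rewrite /qre /qform mulmx0 mxE.
have := zg1 j; have := zg0 j; set s := \sum_k _ => s0 s1.
by rewrite mulr0 add0r ler_pdivrMr; lra.
Qed.

(** * Comparison of the two optimal values *)

Theorem theorem3p4 (R : realType) (N M Q : nat) (eps : R)
  (H : 'I_M -> 'M[R[i]]_N) :
  (2 <= N)%N -> (2 <= M)%N -> (1 <= Q)%N -> (Q <= M - 1)%N ->
  0 < eps < 1 ->
  (forall i, psd (H i)) ->
  (((eps / ctilde M Q eps) * (1 / (4 * ln (100 * K_const H))))%:E
     * @v_SDP R N M Q eps H <= @v_QP R N M Q eps H)%E.
Proof.
move=> _ M2 _ QM /andP[e0 e1] psdH.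
have {}QM : (Q <= M)%N by lia.
have card_beta (A : {set 'I_M}) : (\sum_(i < M) ((i \in A) : nat))%N = #|A|.
  by rewrite -sum1_card [RHS]big_mkcond; apply: eq_bigr => i _; case: (_ \in _).
have [nz|z0] := pselect (exists i, H i != 0); last first.
  have H0 i : H i = 0 by apply/eqP/negPn/negP => Hi; apply: z0; exists i.
  have -> : K_const H = 0.
    apply: big1 => i _; rewrite H0 mxrank0.
    by apply/min_idPl; rewrite sqrtr_ge0.
  (* If all [H i] vanish then [K_const H = 0]; with the conventions [ln 0 = 0] and [0^-1 = 0] the
     left side is 0, even for an infinite [v_SDP], and [w = 0] attains it. *)
  rewrite mulr0 ln0 // mulr0 invr0 !mulr0 mul0e.
  apply: ereal_sup_ubound; exists 0 => //.
  have /card_geqP[s [us sQ _]] : (Q <= #|'I_M|)%N by rewrite card_ord.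
  exists 0, (fun i => i \in [set i in s]); split.
  - move=> i; rewrite /qform mulmx0 mxE -[leLHS]/(0%:C) lecR.
    by case: (_ \in _) => /=; lra.
  - by rewrite card_beta cardsE (card_uniqP us).
  - by rewrite /normsq big1 // => k _; rewrite mxE /= expr0n addr0.
set c := ctilde M Q eps; set L := 4 * ln _.
have D0 : 0 < (M - Q)%:R + 1 :> R by rewrite ltr_wpDl ?ler0n.
have th1 : ((M - Q)%:R + 1)^-1 <= 1 :> R by rewrite invf_le1 // lerDr ler0n.
have cE : c = 1 - (1 - eps) * ((M - Q)%:R + 1)^-1 by [].
have ce : eps <= c by rewrite cE; nra.
have c0 : 0 < c by apply: lt_le_trans ce.
have L0 : 0 < L.
  rewrite mulr_gt0 // ln_gt0 //.
  have := card_nonzero_le_K H (ltnW M2).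
  have : 1 <= #|[pred i | H i != 0]|%:R :> R.
    by rewrite ler1n; apply/card_gt0P; case: nz => i Hi; exists i.
  by lra.
rewrite -ereal_sup_pZl; last by rewrite mulr_gt0 ?divr_gt0.
apply/ereal_supP => _ [_ [_ [X [beta [psdX HX bQ b01 ->]] <-] <-]].
have [|A [AQ Ab]] := @exists_large_coordinates R M Q beta QM bQ.
  by move=> i; case/andP: (b01 i).
pose bnd i : R := (i \in A)%:R * eps + (1 - (i \in A)%:R).
have bnd0 i : 0 < bnd i by rewrite /bnd; case: (_ \in _) => /=; lra.
have [|i|w [wX wH]] := @exists_sign_rounding R N M H
  (fun i => eps / c / bnd i) X psdH psdX nz.
- by move=> i; rewrite !divr_ge0 // ltW.
- have := HX i; rewrite lecE /= => /andP[_ hi].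
  have /andP[b0 b1] := b01 i.
  rewrite mulrAC ler_pdivrMr // mul1r mulrAC ler_pdivrMr //.
  (* On [A] the bound is [eps], and [beta i >= th] gives trace at most [1 - (1 - eps) th = c]. Off
     [A] the bound is 1, the trace is at most 1, and [eps <= c]. *)
  rewrite /bnd; case: (boolP (i \in A)) => [/Ab Ai|_] /=.
    rewrite subrr addr0 mul1r ler_pM2l // (le_trans hi) // cE.
    set th := _^-1 in Ai *; nra.
  rewrite mul0r add0r subr0 mul1r (le_trans _ ce) // ger_pMr //.
  by apply: le_trans hi _; nra.
apply: ereal_sup_ubound; exists (eps / c * (1 / L) * complex.Re (\tr X)) => //.
(* Scaling [w] by this root turns [eps / c / bnd i * qre (H i) w <= L] into feasibility. *)
exists ((Num.sqrt (eps / c / L))%:C *: w), (fun i => i \in A); split.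
- move=> i; rewrite qformZ qformE // -rmorphM lecR sqr_sqrtr; last first.
    by rewrite !divr_ge0 // ltW.
  rewrite -/(bnd i) -(ler_pM2l (divr_gt0 L0 (bnd0 i))) -[leRHS]mulrA mulVf ?gt_eqF // mulr1.
  apply: le_trans (wH i); rewrite le_eqVlt; apply/orP; left; apply/eqP.
  by field; rewrite !gt_eqF.
- by rewrite card_beta.
- rewrite normsqZ wX sqr_sqrtr ?mul1r //.
  by rewrite !divr_ge0 // ltW.
Qed.
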